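(* Let $Z$ be an exponential random variable with mean $1$. For each positive even integer $n$, let $\tau$ be an eigenvalue of the Bernoulli-Laplace Markov chain with parameter $n$, chosen uniformly from its $\binom{n}{n/2}$ eigenvalues (counted with multiplicity), and let $W := \frac{n}{2}\tau+1$. Then there is a universal constant $C$ such that for all positive even $n$ and all $t$, $$\left|\mathbb{P}\{W\le t\}-\mathbb{P}\{Z\le t\}\right| \le \frac{C}{\sqrt{n}}.$$ Moreover this rate is sharp in the sense that there is a sequence of (even) $n$'s tending to infinity, and corresponding $t_n$'s, such that along this sequence $$\left|\mathbb{P}(W\le t_n)-\mathbb{P}(Z\le t_n)\right| = \frac{2e^{-2}}{\sqrt{n}} + O(1/n).$$
   Context: The Bernoulli-Laplace Markov chain with parameter $n$ ($n$ even): there are two urns, each holding $\frac n2$ balls; the first initially contains $\frac n2$ white balls and the second $\frac n2$ black balls. At each stage a ball is picked uniformly at random from each urn and the two are switched. Equivalently, it is the simple random walk on the Johnson graph $J(n,\frac n2)$, whose vertices are the $\frac n2$-element subsets of $\{1,\dots,n\}$, two subsets being adjacent if they differ in exactly one element (i.e. their intersection has $\frac n2-1$ elements); its transition matrix has size $\binom{n}{n/2}$. Its spectrum is known to consist of the numbers $1-\frac{i(n-i+1)}{(n/2)^2}$, occurring with multiplicity $\binom{n}{i}-\binom{n}{i-1}$ for $1\le i\le \frac n2$, and with multiplicity $1$ for $i=0$. Equivalently, $W=W(i)=\frac{(n-2i)(n+2-2i)}{2n}$, where $i\in\{0,1,\dots,\frac n2\}$ is chosen with probability $\pi(i)=\left(\binom{n}{i}-\binom{n}{i-1}\right)/\binom{n}{n/2}$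 for $1\le i\le \frac n2$ and $\pi(0)=1/\binom{n}{n/2}$. *)

(* Defs.v *)
From HB Require Import structures.
From mathcomp Require Import all_boot all_order all_algebra.
From mathcomp Require Import all_classical all_reals all_analysis.

Set Implicit Arguments.
Unset Strict Implicit.
Unset Printing Implicit Defensive.

Import Order.TTheory GRing.Theory Num.Theory.
Import numFieldNormedType.Exports.

Local Open Scope classical_set_scope.
Local Open Scope ring_scope.

Definition half_subset (n : nat) : finType :=
  {A : {set 'I_n} | #|A| == n./2}.

(* Adjacency in the Johnson graph J(n, n/2): the intersection has n/2 - 1
   elements (written additively, so as to avoid truncated subtraction). *)
Definition johnson_adj (n : nat) : rel (half_subset n) :=
  fun A B => #|val A :&: val B|.+1 == n./2.

(* A is the content of the first urn; one step is a step of the simple random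
   walk on J(n, n/2). *)
Definition bernoulli_laplace_prob (R : realType) (n : nat)
    (A B : half_subset n) : R :=
  if johnson_adj A B then #|[pred D | johnson_adj A D]|%:R^-1 else 0.

Definition bernoulli_laplace (R : realType) (n : nat) :
    'M[R]_#|half_subset n| :=
  \matrix_(i, j) bernoulli_laplace_prob R (enum_val i) (enum_val j).

(* The matrix is real symmetric, so its spectrum is real, and the multiplicity
   of an eigenvalue is its multiplicity as a root of the characteristic
   polynomial; mup is 0 at the points that are not eigenvalues. *)
Definition uniform_eigenvalue (R : realType) (n : nat)
    (d : measure_display) (T : measurableType d) (P : probability T R)
    (tau : {RV P >-> R}) : Prop :=
  forall a : R,
    distribution P tau [set a] =
      ((mup a (char_poly (bernoulli_laplace R n)))%:R /
         'C(n, n./2)%:R)%:E.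

Definition exponential_mean1 (R : realType)
    (d : measure_display) (T : measurableType d) (P : probability T R)
    (Z : {RV P >-> R}) : Prop :=
  forall A : set R, measurable A ->
    distribution P Z A = exponential_prob 1 A.

Definition bl_W (R : realType) (n : nat) (T : Type) (tau : T -> R) : T -> R :=
  fun x => n%:R / 2 * tau x + 1.

(* |P(W <= t) - P(Z <= t)|; W and Z may live on different spaces. *)
Definition cdf_gap (R : realType)
    (d : measure_display) (T : measurableType d) (P : probability T R)
    (W : T -> R)
    (d' : measure_display) (T' : measurableType d') (Q : probability T' R)
    (Z : T' -> R) (t : R) : R :=
  `| fine (P [set x | W x <= t]) - fine (Q [set y | Z y <= t]) |.

(* Main.v *)
(* Down-up operators on k-subsets of an n-set (n = 2m) satisfy
   U_k U_k^T = U_(k-1)^T U_(k-1) + (n - 2k), and MN, NM have the same nonzero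
   spectrum; by induction this gives the characteristic polynomial of the chain,
   with W taking the values r(r+1)/m where r = m - i.  The multiplicities
   telescope, so P(W > t) = a_r := C(2m, m+r)/C(2m, m) for
   r(r-1)/m <= t < r(r+1)/m.  A Gaussian estimate shows a_r = exp(-r^2/m) + O(1/m) uniformly in r, while
   exp(-t) differs from exp(-r^2/m) by at most (r/m) exp(-r(r-1)/m), which is
   O(1/sqrt m).  For sharpness take n = 4s^2, r = 2s, t = r(r-1)/m = 2 - 1/s:
   there a_r = exp(-2) + O(1/n) and exp(-t) = exp(-2)(1 + 1/s) + O(1/n). *)
Require Import Defs.
From HB Require Import structures.
From mathcomp Require Import all_boot all_order all_algebra.
From mathcomp Require Import all_classical all_reals all_analysis.
From mathcomp Require Import ring lra zify.

Set Implicit Arguments.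
Unset Strict Implicit.
Unset Printing Implicit Defensive.

Import Order.TTheory GRing.Theory Num.Theory.
Import numFieldNormedType.Exports.

Local Open Scope ring_scope.

(** * Characteristic polynomials of products and affine images *)

(** Sylvester's determinant identity: the block matrix [B] with rows (X, M) and (N, 1) is made block
    triangular once from the right and once from the left. The powers of X balance the two sizes
    without any subtraction. *)
Lemma char_poly_mulmxC (R : comNzRingType) p q (M : 'M[R]_(p, q))
    (N : 'M[R]_(q, p)) :
  'X^q * char_poly (M *m N) = 'X^p * char_poly (N *m M).
Proof.
rewrite /char_poly /char_poly_mx !map_mxM /=.
set M' := map_mx _ M; set N' := map_mx _ N.
pose B := block_mx 'X%:M M' N' 1%:M.
have detB : \det B = \det ('X%:M - M' *m N').
  have := det_mulmx B (block_mx 1%:M 0 (- N') 1%:M).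
  rewrite det_lblock !det1 !mulr1 => <-.
  rewrite mulmx_block !mulmx1 !mul1mx !mulmx0 !add0r mulmxN subrr.
  by rewrite det_ublock det1 mulr1.
rewrite -detB -!det_scalar.
have := det_mulmx (block_mx 1%:M 0 (- N') 'X%:M) B.
rewrite det_lblock !det1 !mul1r => <-.
rewrite mulmx_block !mul1mx !mul0mx !addr0 mulmx1.
rewrite mul_scalar_mx mul_mx_scalar scalerN addNr det_ublock.
by rewrite mulNmx addrC.
Qed.

(** The characteristic polynomial of aM + b is a^p times that of M composed with (X - b)/a. *)
Lemma char_poly_affine (F : fieldType) p (M : 'M[F]_p) (a b : F)
    (I : finType) (l : I -> F) (d : I -> nat) : a != 0 ->
  char_poly M = \prod_i ('X - (l i)%:P) ^+ d i ->
  char_poly (a *: M + b%:M) = \prod_i ('X - (a * l i + b)%:P) ^+ d i.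
Proof.
move=> a0 cM.
pose q : {poly F} := a^-1 *: ('X - b%:P).
have cq : char_poly (a *: M + b%:M) = a ^+ p *: (char_poly M \Po q).
  rewrite /char_poly -[_ \Po _]/(comp_poly q _) -det_map_mx.
  rewrite -mul_polyC rmorphXn -detZ; congr (\det _); apply/matrixP => i j.
  rewrite !mxE /= raddfB raddfMn /= comp_polyC comp_polyX.
  rewrite mulrBr mulrnAr mul_polyC /q scalerA divff // scale1r.
  rewrite polyCD polyCM polyCMn mulrnBl; ring.
have fac i : ('X - (a * l i + b)%:P) = a *: (('X - (l i)%:P) \Po q).
  rewrite comp_polyB comp_polyC comp_polyX /q scalerBr scalerA divff //.
  rewrite scale1r polyCD polyCM mul_polyC; ring.
(* Equality up to a scalar is enough, since both sides are monic; the powers of [a] need not be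
   tracked. *)
have : char_poly (a *: M + b%:M) %= \prod_i ('X - (a * l i + b)%:P) ^+ d i.
  rewrite cq cM rmorph_prod /=.
  rewrite (eqp_ltrans (eqp_scale _ _)) ?expf_neq0 //.
  elim/big_rec2: _ => [|i x y _ xy]; first exact: eqpxx.
  apply: eqp_trans (eqp_mull _ xy); apply: eqp_mulr.
  by rewrite rmorphXn /= fac exprZn eqp_sym eqp_scale // expf_neq0.
have monQ : \prod_i ('X - (a * l i + b)%:P) ^+ d i \is monic.
  by apply: monic_prod => i _; rewrite monic_exp ?monicXsubC.
by move/eqp_eq; rewrite (monicP monQ) (monicP (char_poly_monic _)) !scale1r.
Qed.

(** * Subsets of fixed size *)

Definition ksubset (n k : nat) : finType := {A : {set 'I_n} | #|A| == k}.

Lemma card_ksubset n k : #|ksubset n k| = 'C(n, k).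
Proof.
have := card_draws 'I_n k; rewrite card_ord => <-.
rewrite -(card_imset _ val_inj).
apply: eq_card => A; rewrite inE; apply/imsetP/idP => [[B _ ->]|kA].
  exact: (valP B).
by exists (Sub A kA).
Qed.

Definition ksub n k (i : 'I_#|ksubset n k|) : {set 'I_n} := val (enum_val i).

Lemma card_ksub n k (i : 'I_#|ksubset n k|) : #|ksub i| = k.
Proof. exact/eqP/(valP (enum_val i)). Qed.

Lemma ksub_inj n k : injective (@ksub n k).
Proof. exact: inj_comp val_inj enum_val_inj. Qed.

Lemma sum_ksubset (V : nmodType) n k (F : {set 'I_n} -> V) :
  \sum_(i < #|ksubset n k|) F (ksub i) =
    \sum_(A : {set 'I_n} | #|A| == k) F A.
Proof.
rewrite -(big_enum_val (fun x : ksubset n k => F (val x))).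
exact/esym/(big_sub [pred A : {set 'I_n} | #|A| == k] F).
Qed.

Lemma card_subsets_of n k (D : {set 'I_n}) :
  (\sum_(A : {set 'I_n} | #|A| == k) (A \subset D) = 'C(#|D|, k))%N.
Proof.
rewrite -cards_draws -sum1dep_card [RHS]big_mkcond /= big_mkcond.
by apply: eq_bigr => A _; case: eqP => _; rewrite ?andbT ?andbF.
Qed.

(** Complementation turns supersets of [D] into subsets of its complement. *)
Lemma card_supersets_of n k (D : {set 'I_n}) : (k <= n)%N ->
  (\sum_(A : {set 'I_n} | #|A| == k) (D \subset A) = 'C(n - #|D|, n - k))%N.
Proof.
move=> kn; have cD (A : {set 'I_n}) : #|~: A| = (n - #|A|)%N.
  by rewrite cardsCs finset.setCK card_ord.
rewrite -cD -card_subsets_of.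
rewrite (reindex_inj (@finset.setC_inj 'I_n : injective _)) /=.
apply: eq_big => [A|A _]; last by rewrite -[in RHS]finset.setCS !finset.setCK.
have : (#|A| <= n)%N by rewrite -[leqRHS]card_ord max_card.
rewrite cD; move: (#|A|) => a an; apply/eqP/eqP; lia.
Qed.

(** * Inclusion matrices and the spectrum of the down-up operator *)

Section Johnson.
Variable R : fieldType.

Definition inclusion_mx n k : 'M[R]_(#|ksubset n k|, #|ksubset n k.+1|) :=
  \matrix_(i, j) (ksub i \subset ksub j)%:R.

Definition down_up_mx n k : 'M[R]_#|ksubset n k.+1| :=
  (inclusion_mx n k)^T *m inclusion_mx n k.

Lemma natrM_bool (a b : bool) : a%:R * b%:R = (a && b)%:R :> R.
Proof. by rewrite -natrM mulnb. Qed.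

(** The entry counts the [k]-subsets contained in both sets. *)
Lemma down_up_mxE n k i j :
  down_up_mx n k i j =
    'C(#|ksub i :&: ksub j|, k)%:R.
Proof.
rewrite -card_subsets_of -sum_ksubset natr_sum mxE.
by apply: eq_bigr => l _; rewrite !mxE natrM_bool finset.subsetI.
Qed.

Lemma up_downE n k i j : (k < n)%N ->
  (inclusion_mx n k *m (inclusion_mx n k)^T) i j =
    'C(n - #|ksub i :|: ksub j|, n - k.+1)%:R.
Proof.
move=> kn; rewrite -card_supersets_of // -sum_ksubset natr_sum mxE.
by apply: eq_bigr => l _; rewrite !mxE natrM_bool finset.subUset.
Qed.

(** Reduces the entrywise matrix comparisons below to arithmetic on cardinalities. *)
Lemma card_ksubI n k (i j : 'I_#|ksubset n k|) :
  [/\ #|ksub i :&: ksub j| <= k,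
      #|ksub i :|: ksub j| + #|ksub i :&: ksub j| = k + k
    & (#|ksub i :&: ksub j| == k) = (i == j)]%N.
Proof.
have ci := card_ksub i; have cj := card_ksub j.
split; first by rewrite -[leqRHS]ci subset_leq_card // finset.subsetIl.
  by rewrite cardsUI ci cj.
apply/eqP/eqP => [c|->]; last by rewrite finset.setIid.
have ei : ksub i :&: ksub j = ksub i.
  by apply/eqP; rewrite eqEcard finset.subsetIl c ci /=.
have ej : ksub i :&: ksub j = ksub j.
  by apply/eqP; rewrite eqEcard finset.subsetIr c cj /=.
by apply: ksub_inj; rewrite -[LHS]ei.
Qed.

Lemma up_down_mx0 n : (0 < n)%N ->
  inclusion_mx n 0 *m (inclusion_mx n 0)^T = n%:R%:M.
Proof.
move=> n0; apply/matrixP => i j; rewrite up_downE // mxE.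
have [le0 e eqij] := card_ksubI i j.
have -> : (i == j) = true by rewrite -eqij; lia.
have -> : #|ksub i :|: ksub j| = 0%N by lia.
by rewrite subn0 bin_sub // bin1 mulr1n.
Qed.

(** Off the diagonal both products have entry 1 for sets meeting in [k] elements and 0 otherwise;
    the diagonal entries are n - k - 1 and k + 1, whence the scalar. *)
Lemma up_down_mxS n k : (k.+1 < n)%N ->
  inclusion_mx n k.+1 *m (inclusion_mx n k.+1)^T =
    down_up_mx n k + (n%:R - k.+1.*2%:R)%:M.
Proof.
move=> kn; apply/matrixP => i j; rewrite up_downE // [RHS]mxE down_up_mxE mxE.
have [lek e eqij] := card_ksubI i j.
have cU : (#|ksub i :|: ksub j| <= n)%N.
  by rewrite -[leqRHS]card_ord max_card.
move: eqij; move=> <-.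
set x := #|_ :&: _| in lek e *; set y := #|_ :|: _| in cU e *.
case: eqP => [xk|xk].
  have -> : y = k.+1 by lia.
  have -> : (n - k.+1 = (n - k.+2).+1)%N by lia.
  rewrite xk !binSn mulr1n -mul2n natrM.
  have -> : ((n - k.+2).+1 = n - k.+1)%N by lia.
  by rewrite natrB 1?ltnW //; ring.
rewrite mulr0n addr0; congr (_%:R).
have [x_eq|x_lt] := eqVneq x k.
  by rewrite x_eq binn (_ : n - y = n - k.+2)%N ?binn //; lia.
by rewrite !bin_small //; lia.
Qed.

Lemma sum_inclusion_col n k (j : 'I_#|ksubset n k.+1|) :
  \sum_i inclusion_mx n k i j = k.+1%:R.
Proof.
under eq_bigr do rewrite mxE.
rewrite (sum_ksubset k (fun A => (A \subset ksub j)%:R)) -natr_sum.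
by rewrite card_subsets_of card_ksub binSn.
Qed.

Lemma sum_inclusion_row n k (i : 'I_#|ksubset n k|) : (k < n)%N ->
  \sum_j inclusion_mx n k i j = (n - k)%:R.
Proof.
move=> kn; under eq_bigr do rewrite mxE.
rewrite (sum_ksubset k.+1 (fun A => (ksub i \subset A)%:R)) -natr_sum.
rewrite card_supersets_of // card_ksub.
by rewrite (_ : n - k = (n - k.+1).+1)%N ?binSn //; lia.
Qed.

Lemma sum_down_up_row n k (i : 'I_#|ksubset n k.+1|) : (k < n)%N ->
  \sum_j down_up_mx n k i j = (k.+1 * (n - k))%:R.
Proof.
move=> kn; under eq_bigr do rewrite mxE.
rewrite exchange_big /=.
under eq_bigr => l _ do rewrite mxE -big_distrr sum_inclusion_row //=.
by rewrite -big_distrl sum_inclusion_col natrM.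
Qed.

(** The truncated subtraction is exact for 2j <= n, where the binomial coefficients increase; the
    value 0 stands for C(n, -1). *)
Definition johnson_mult n j :=
  ('C(n, j) - (if j is j'.+1 then 'C(n, j') else 0))%N.

(** Here [k] is the size of the subsets, so [down_up_mx n k] takes the argument [k.+1]. The value at
    j = k is 0. *)
Definition down_up_eigenvalue n k j : R :=
  (k%:R - j%:R) * (n%:R - k%:R - j%:R + 1).

(** Induction on the size: exchanging the two factors adds only zero eigenvalues, and the
    commutation relation shifts all of them by a scalar. *)
Lemma char_poly_down_up n k : (k.*2.+1 < n)%N ->
  char_poly (down_up_mx n k) =
    \prod_(j < k.+2)
      ('X - (down_up_eigenvalue n k.+1 j)%:P) ^+ johnson_mult n j.
Proof.
pose factor l j : {poly R} :=
  ('X - (down_up_eigenvalue n l j)%:P) ^+ johnson_mult n j.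
have step l : (l.*2.+1 < n)%N ->
    char_poly (inclusion_mx n l *m (inclusion_mx n l)^T) =
      \prod_(j < l.+1) factor l.+1 j ->
  char_poly (down_up_mx n l) = \prod_(j < l.+2) factor l.+1 j.
  move=> ln cp.
  have := char_poly_mulmxC (inclusion_mx n l) (inclusion_mx n l)^T.
  rewrite -/(down_up_mx n l) cp; move: (char_poly _) => P.
  rewrite !card_ksubset [in X in _ -> X]big_ord_recr /=.
  set Q := \prod_(i < _) _; move=> e.
  have cle : ('C(n, l) <= 'C(n, l.+1))%N.
    rewrite -(@leq_pmul2l l.+1) // mul_bin_left leq_mul2r.
    by apply/orP; right; lia.
  (* Cancelling this power leaves X to the power C(n, l+1) - C(n, l): the new eigenvalue 0, which is
     the factor with j = l + 1. *)
  apply: (@mulfI _ ('X^('C(n, l)))); first by rewrite expf_neq0 ?polyX_eq0.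
  rewrite -e mulrCA mulrC; congr (_ * _).
  rewrite /factor /johnson_mult /down_up_eigenvalue subrr mul0r subr0.
  by rewrite -exprD subnKC.
elim: k => [|k IHk] kn; apply: step => //.
  rewrite up_down_mx0; last by lia.
  rewrite big_ord1 /char_poly /char_poly_mx map_scalar_mx -raddfB det_scalar.
  rewrite card_ksubset /factor /johnson_mult /down_up_eigenvalue.
  by congr (('X - _%:P) ^+ _); rewrite /= ?subn0 //; ring.
rewrite up_down_mxS; last by lia.
have kn' : (k.*2.+1 < n)%N by lia.
(* An affine map of slope 1. With a = k + 1 the shift reads (a - j)(n - a - j + 1) + n - 2a = (a + 1
   - j)(n - a - j). *)
rewrite -[X in X + _]scale1r (char_poly_affine _ (oner_neq0 _) (IHk kn')).
apply: eq_bigr => j _; congr (('X - _%:P) ^+ _).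
by rewrite /down_up_eigenvalue -mul2n natrM -[k.+2%:R]natr1; ring.
Qed.
End Johnson.

(** * The Johnson walk and the spectrum of the chain *)

(** At k = n/2 this is convertible with [bernoulli_laplace_prob]; a free [k] allows rewriting n/2
    inside the index type. *)
Definition johnson_walk_prob (R : fieldType) n k (A B : ksubset n k) : R :=
  if #|val A :&: val B|.+1 == k
  then #|[pred D : ksubset n k | #|val A :&: val D|.+1 == k]|%:R^-1 else 0.

Definition johnson_walk (R : fieldType) n k : 'M[R]_#|ksubset n k| :=
  \matrix_(i, j) johnson_walk_prob R (enum_val i) (enum_val j).

Lemma down_up_mx_adj (R : fieldType) n k (i j : 'I_#|ksubset n k.+1|) :
  down_up_mx R n k i j = (i == j)%:R * k.+1%:R + (#|ksub i :&: ksub j| == k)%:R.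
Proof.
have [le_k _ <-] := card_ksubI i j; rewrite down_up_mxE; move: le_k.
case: ltngtP => // [lt_k _|-> _]; last first.
  by rewrite binSn mul1r (_ : (_ == _) = false) ?addr0 //; lia.
rewrite mul0r add0r; case: eqP => [->|neq]; first by rewrite binn.
by rewrite bin_small //; lia.
Qed.

(** Read off from the row sum (k+1)(n-k) of the down-up matrix: removing the diagonal entry k + 1
    leaves the number of neighbours. Working over [rat] loses nothing, as the characteristic is
    0. *)
Lemma johnson_degree n k (i : 'I_#|ksubset n k.+1|) : (k < n)%N ->
  #|[pred D : ksubset n k.+1 | #|ksub i :&: val D|.+1 == k.+1]| =
    (k.+1 * (n - k.+1))%N.
Proof.
move=> kn; have := sum_down_up_row rat i kn.
under eq_bigr do rewrite down_up_mx_adj.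
rewrite big_split /= (bigD1 i) //= eqxx mul1r big1 ?addr0; last first.
  by move=> j /negPf ji; rewrite eq_sym ji mul0r.
rewrite -natr_sum -natrD => /eqP; rewrite eqr_nat => /eqP.
have -> : (\sum_(j < #|ksubset n k.+1|) (#|ksub i :&: ksub j| == k) =
    #|[pred D : ksubset n k.+1 | #|ksub i :&: val D|.+1 == k.+1]|)%N.
  rewrite -[RHS]sum1_card [RHS]big_mkcond /=.
  pose f (D : ksubset n k.+1) : nat := #|ksub i :&: val D| == k.
  rewrite -(big_enum_val f).
  by apply: eq_bigr => D _; rewrite /f inE eqSS; case: eqP.
move=> e; apply: (@addnI k.+1); rewrite [LHS]e -mulnS; congr muln; lia.
Qed.

Lemma johnson_walkE (R : numFieldType) k :
  johnson_walk R k.+1.*2 k.+1 =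
    (k.+1%:R ^- 2) *: down_up_mx R k.+1.*2 k + (- k.+1%:R^-1)%:M.
Proof.
apply/matrixP => i j; rewrite [RHS]mxE [_%:M i j]mxE mxE [X in _ = X + _]mxE.
rewrite down_up_mx_adj /johnson_walk_prob -/(ksub i) -/(ksub j) eqSS.
rewrite johnson_degree; last by lia.
rewrite (_ : k.+1.*2 - k.+1 = k.+1)%N; last by lia.
have k0 : k.+1%:R != 0 :> R by rewrite pnatr_eq0.
have [_ _ <-] := card_ksubI i j.
case: eqP => [->|_]; last by case: eqP => _; rewrite /= ?mulr1n ?mulr0n; field.
rewrite (_ : (k == k.+1) = false); last by lia.
by rewrite natrM /= mulr0n; field.
Qed.

(** Equal to the classical 1 - j(2m - j + 1)/m^2; in this form m tau + 1 is visibly r(r+1)/m with r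
    = m - j. *)
Definition bl_eigenvalue (R : fieldType) m j : R :=
  (m%:R - j%:R) * (m%:R - j%:R + 1) / m%:R ^+ 2 - m%:R^-1.

Lemma char_poly_bernoulli_laplace (R : realType) m : (0 < m)%N ->
  char_poly (bernoulli_laplace R m.*2) =
    \prod_(j < m.+1) ('X - (bl_eigenvalue R m j)%:P) ^+ johnson_mult m.*2 j.
Proof.
move=> m0.
have -> : char_poly (bernoulli_laplace R m.*2) =
          char_poly (johnson_walk R m.*2 m.*2./2) by [].
rewrite doubleK; case: m m0 => // k _.
rewrite johnson_walkE (char_poly_affine _ _ (char_poly_down_up _ _)).
- apply: eq_bigr => j _; congr (('X - _%:P) ^+ _).
  rewrite /bl_eigenvalue /down_up_eigenvalue -mul2n natrM.
  have k0 : k.+1%:R != 0 :> R by rewrite pnatr_eq0.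
  by field.
- by rewrite invr_eq0 expf_neq0 ?pnatr_eq0.
- lia.
Qed.

Lemma sum_johnson_mult n k : (k.*2 <= n)%N ->
  (\sum_(j < k.+1) johnson_mult n j = 'C(n, k))%N.
Proof.
elim: k => [|k IHk] kn; first by rewrite big_ord1 /johnson_mult subn0.
rewrite big_ord_recr /= IHk ?[johnson_mult _ _]/(_ - _)%N; last by lia.
rewrite subnKC //.
rewrite -(@leq_pmul2l k.+1) // mul_bin_left leq_mul2r.
by apply/orP; right; lia.
Qed.

Lemma mup_prod_XsubC_exp (F : fieldType) (I : finType) (l : I -> F)
    (d : I -> nat) (i : I) : injective l ->
  mup (l i) (\prod_j ('X - (l j)%:P) ^+ d j) = d i.
Proof.
move=> l_inj; rewrite (bigD1 i) //= mupMl ?mup_XsubCX ?eqxx //.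
rewrite rootE horner_prod prodf_seq_neq0; apply/allP => j _; apply/implyP => ji.
rewrite horner_exp hornerXsubC expf_neq0 // subr_eq0.
by rewrite (inj_eq l_inj) eq_sym.
Qed.

Lemma natr_pronic (R : pzRingType) m j : (j <= m)%N ->
  (m%:R - j%:R) * (m%:R - j%:R + 1) = ((m - j) * (m - j).+1)%:R :> R.
Proof. by move=> jm; rewrite -natrB // natr1 natrM. Qed.

(** Since r(r+1) is strictly increasing in the natural number r = m - j, no two factors of the
    characteristic polynomial merge, and [mup] returns exactly [johnson_mult]. *)
Lemma bl_eigenvalue_inj (R : numFieldType) m : (0 < m)%N ->
  injective (fun j : 'I_m.+1 => bl_eigenvalue R m j).
Proof.
move=> m0 i j; rewrite /bl_eigenvalue => /addIr.
have mn0 : m%:R ^+ 2 != 0 :> R by rewrite expf_neq0 // pnatr_eq0 -lt0n.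
move/(mulIf (invr_neq0 mn0)); rewrite !natr_pronic ?leq_ord // => /eqP.
rewrite eqr_nat => /eqP e; apply/val_inj => /=.
have := leq_ord i; have := leq_ord j; nia.
Qed.

(** * Distribution functions of W and of the exponential law *)

Local Open Scope classical_set_scope.
Local Open Scope ring_scope.

(* The point masses already add up to 1, so nothing is left elsewhere. *)
Lemma probability_sum_atoms (R : realType) (d : measure_display)
    (T : measurableType d) (P : probability T R) n (l : 'I_n -> T)
    (p : 'I_n -> R) (B : set T) :
  (forall x : T, measurable [set x]) -> injective l ->
  (forall i, P [set l i] = (p i)%:E) -> \sum_i p i = 1 -> measurable B ->
  P B = (\sum_(i | l i \in B) p i)%:E.
Proof.
move=> m1 l_inj Pl sum_p mB.
have ge_sum (A : set T) : measurable A ->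
    ((\sum_(i | l i \in A) p i)%:E <= P A)%E.
  move=> mA.
  have -> : (\sum_(i | l i \in A) p i)%:E =
      P (\big[setU/set0]_(i < n | l i \in A) [set l i]).
    rewrite measure_bigsetU_ord //.
      by rewrite -sumEFin; apply: eq_bigr => i _; exact/esym/Pl.
    by move=> i j _ _ [x [/= -> /l_inj]].
  have mS : measurable (\big[setU/set0]_(i < n | l i \in A) [set l i]).
    exact: bigsetU_measurable.
  apply: le_measure; rewrite ?inE //.
  by elim/big_ind: _ => [x []|A1 A2 h1 h2 x [/h1|/h2]|i /set_mem lA x ->].
apply/eqP; rewrite eq_le ge_sum // andbT.
have := ge_sum _ (measurableC mB); rewrite probability_setC // -sum_p.
under eq_bigl do rewrite in_setC.
rewrite [in X in (_ <= X)%E](bigID (fun i => l i \in B)) /=.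
rewrite -(fineK (fin_num_measure P _ mB)) -EFinB !lee_fin; lra.
Qed.

(** The tail probability a_r of the overview; it is 0 for r > m. *)
Definition bin_ratio (R : fieldType) m r : R :=
  'C(m.*2, m + r)%:R / 'C(m.*2, m)%:R.

(** The sum telescopes to C(2m, m - r), and the symmetry of binomial coefficients does the rest. For
    r > m both sides are 0. *)
Lemma sum_johnson_mult_tail m r :
  (\sum_(j < m.+1 | j + r <= m) johnson_mult m.*2 j = 'C(m.*2, m + r))%N.
Proof.
case: (leqP r m) => [rm|mr]; last first.
  by rewrite bin_small ?big_pred0 // => [i|]; lia.
have -> : 'C(m.*2, m + r) = 'C(m.*2, m - r).
  by rewrite -bin_sub; [congr 'C(_, _)|]; lia.
rewrite -sum_johnson_mult; last by lia.
rewrite (big_ord_widen m.+1); last by lia.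
by apply: eq_bigl => j; lia.
Qed.

(** The hypothesis on [r] says that exactly the first [r] values i(i+1)/m are at most [t]; taking r
    = 0 covers negative [t]. *)
Lemma bl_cdf (R : realType) m (d : measure_display) (T : measurableType d)
    (P : probability T R) (tau : {RV P >-> R}) (t : R) r : (0 < m)%N ->
  uniform_eigenvalue m.*2 tau ->
  (forall i, (i <= m)%N -> ((i * i.+1)%:R / m%:R <= t) = (i < r)%N) ->
  P [set x | bl_W m.*2 tau x <= t] = (1 - bin_ratio R m r)%:E.
Proof.
move=> m0 tauP tr.
pose p (j : 'I_m.+1) : R := (johnson_mult m.*2 j)%:R / 'C(m.*2, m)%:R.
have C0 : 'C(m.*2, m)%:R != 0 :> R.
  by rewrite pnatr_eq0 -lt0n bin_gt0; lia.
have tau_atom (j : 'I_m.+1) :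
    distribution P tau [set bl_eigenvalue R m j] = (p j)%:E.
  rewrite tauP char_poly_bernoulli_laplace // doubleK.
  by rewrite (mup_prod_XsubC_exp _ _ (bl_eigenvalue_inj m0)).
have sum_p : \sum_j p j = 1.
  by rewrite -mulr_suml -natr_sum sum_johnson_mult ?divff // leqnn.
have mR : 0 < m%:R :> R by rewrite ltr0n.
pose B : set R := `]-oo, (t - 1) / m%:R]%classic.
have W_le a : (m.*2%:R / 2 * a + 1 <= t) = (a \in B).
  have -> : m.*2%:R / 2 = m%:R :> R by rewrite -mul2n natrM; field.
  by rewrite /B mem_setE in_itv /= ler_pdivlMr // lerBrDr mulrC.
have -> : [set x | bl_W m.*2 tau x <= t] = tau @^-1` B.
  by apply/seteqP; split=> x /=; rewrite /bl_W W_le inE.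
have -> : P (tau @^-1` B) = distribution P tau B by [].
rewrite (probability_sum_atoms (fun x => measurable_set1 x)
  (bl_eigenvalue_inj m0) tau_atom) //;
  last exact: measurable_itv.
congr EFin; rewrite -sum_p.
rewrite [in RHS](bigID (fun i : 'I_m.+1 => bl_eigenvalue R m i \in B)) /=.
have tail : \sum_(i < m.+1 | bl_eigenvalue R m i \notin B) p i =
    bin_ratio R m r.
  rewrite /bin_ratio -sum_johnson_mult_tail natr_sum mulr_suml.
  apply: eq_bigl => j.
  (* The eigenvalue of index j gives W the value i(i+1)/m with i = m - j. *)
  have -> : (bl_eigenvalue R m j \in B) = (m - j < r)%N.
    rewrite -tr ?leq_subr // -W_le -natr_pronic ?leq_ord //; congr (_ <= _).
    by rewrite /bl_eigenvalue -mul2n natrM; field; rewrite pnatr_eq0 -lt0n.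
  by have := leq_ord j; lia.
by rewrite -tail; exact/esym/addrK.
Qed.

(** The density vanishes off [0, oo), so the half-line may be cut down to [0, t], which is empty for
    t < 0 and a null set for t = 0. *)
Lemma exponential_cdf (R : realType) (t : R) :
  exponential_prob 1 `]-oo, t]%classic =
    (if 0 <= t then 1 - expR (- t) else 0)%:E :> \bar R.
Proof.
pose D : set R := `[0, +oo[%classic; pose f := EFin \o exponential_pdf (1 : R).
have fD : f \_ D = f.
  apply/funext => x; rewrite /f /exponential_pdf /patch /=.
  by case: ifP => /= h; rewrite ?h.
have restr (V : set R) : exponential_prob 1 V = exponential_prob 1 (V `&` D).
  transitivity (\int[lebesgue_measure]_(x in V) ((f \_ D) x))%E.
    by rewrite fD.
  exact/esym/integral_mkcondr.
rewrite restr /D; have [t0|t0] := leP 0 t; last first.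
  rewrite [X in exponential_prob 1 X](_ : _ = set0).
    by rewrite /exponential_prob integral_set0.
  by apply/seteqP; split=> x //= []; rewrite !in_itv /= ?andbT; lra.
rewrite (_ : _ `&` _ = `[0, t]%classic); last first.
  apply/seteqP; split=> x /=; rewrite !in_itv /= ?andbT; first by case=> -> ->.
  by case/andP.
move: t0; rewrite le_eqVlt => /predU1P[<-|t0].
  by rewrite set_itv1 /exponential_prob integral_set1 oppr0 expR0 subrr.
by rewrite exponential_prob_itv0c // mulN1r EFinB.
Qed.

(** * Elementary inequalities for the exponential *)

Section ExponentialBounds.
Variable R : realType.
Implicit Types x y u t a b : R.

Lemma expR_ge_taylor3 x : 0 <= x -> 1 + x + x ^+ 2 / 2 + x ^+ 3 / 6 <= expR x.
Proof.
move=> x0.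
have -> : 1 + x + x ^+ 2 / 2 + x ^+ 3 / 6 = series (exp_coeff x) 4.
  rewrite /series /= !big_nat_recr //= big_nil /exp_coeff /= !factS fact0.
  by rewrite !muln1; field.
apply: nondecreasing_cvgn_le (is_cvg_series_exp_coeff x) 4.
apply/nondecreasing_seqP => n; rewrite /series /= big_nat_recr //= lerDl.
exact: exp_coeff_ge0.
Qed.

(** Gives (1 - x)/(1 + x) <= exp(-2x). The difference [f] vanishes at 0 and is nondecreasing. *)
Lemma expR_pade_le x : 0 <= x -> (1 - x) * expR (2 * x) <= 1 + x.
Proof.
move=> x0; pose f y := 1 + y - (1 - y) * expR (2 * y).
have df y : is_derive y 1 f (1 - (1 - 2 * y) * expR (2 * y)).
  rewrite /f; apply: is_derive_eq; rewrite /GRing.scale /=; ring.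
rewrite -subr_ge0 -/(f x); have -> : 0 = f 0 by rewrite /f mulr0 expR0; ring.
apply: (@ger0_derive1_le_cc _ f 0 x) => //.
(* The derivative is nonnegative because 1 - 2y <= exp(-2y). *)
- move=> y _; rewrite derive1E derive_val.
  have := expRxMexpNx_1 (2 * y); have := expR_ge1Dx (- (2 * y)).
  have := expR_gt0 (2 * y); nra.
- apply: continuous_subspaceT => y; apply: differentiable_continuous.
  exact/derivable1_diffP/ex_derive.
- by rewrite in_itv /= lexx.
- by rewrite in_itv /= x0 lexx.
Qed.

(** Multiplied by 1 - x, for x <= 1, this gives (1 - x)/(1 + x) >= exp(-2x)(1 - x^3). *)
Lemma expR_pade_ge x : 0 <= x -> (1 + x) * (1 + x + x ^+ 2) <= expR (2 * x).
Proof.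
move=> x0; apply: le_trans (expR_ge_taylor3 _); last by rewrite mulr_ge0.
have : 0 <= x ^+ 3 by rewrite exprn_ge0.
by nra.
Qed.

Lemma mulr_expRN_le1 y : y * expR (- y) <= 1.
Proof.
rewrite expRN ler_pdivrMr ?expR_gt0 // mul1r.
by apply: le_trans (expR_ge1Dx y); rewrite lerDr.
Qed.

Lemma sqr_expRN_le2 y : 0 <= y -> y ^+ 2 * expR (- y) <= 2.
Proof.
move=> y0; rewrite expRN ler_pdivrMr ?expR_gt0 //.
by have := expR_ge1Dxn 1 y0; rewrite (_ : 2`! = 2)%N //; lra.
Qed.

(** A mean value estimate: for u <= t the difference is exp(-u)(1 - exp(-(t - u))), at most
    exp(-a)(t - u). *)
Lemma expRN_dist a b u t : a <= u -> a <= t -> `|u - t| <= b ->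
  `|expR (- u) - expR (- t)| <= b * expR (- a).
Proof.
wlog ut : u t / u <= t => [hw|] au at_ b_ge.
  have [ut|/ltW tu] := leP u t; first exact: hw.
  by rewrite distrC; apply: hw; rewrite // distrC.
rewrite ger0_norm ?subr_ge0 ?ler_expR ?lerN2 //.
have -> : expR (- t) = expR (- u) * expR (- (t - u)).
  by rewrite -expRD; congr expR; ring.
have := expR_ge1Dx (- (t - u)).
have : expR (- u) <= expR (- a) by rewrite ler_expR lerN2.
have := expR_gt0 (- u); have := expR_gt0 (- a).
move: b_ge; rewrite distrC ger0_norm ?subr_ge0 // => b_ge.
move: (expR (- u)) (expR (- a)) (expR (- (t - u))) => U A E A0 U0 UA EE.
have : U * (1 - E) <= U * b by apply: ler_wpM2l; lra.
have : U * b <= A * b by apply: ler_wpM2r; lra.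
lra.
Qed.

Lemma expR_sub2 u : 0 <= u <= 2 ->
  `|expR (- (2 - u)) - expR (- 2) - expR (- 2) * u| <= u ^+ 2.
Proof.
move=> /andP[u0 u2].
have -> : - (2 - u) = - 2 + u :> R by ring.
rewrite expRD; set e := expR (- 2); set E := expR u.
have Eu : E <= 1 + u * E.
  have : E * (1 - u) <= E * expR (- u).
    by rewrite ler_pM2l ?expR_gt0 // expR_ge1Dx.
  by rewrite expRxMexpNx_1; lra.
have E1 : 1 + u <= E by exact: expR_ge1Dx.
have eE : e * E <= 1 by rewrite -expRD expR_le1; lra.
have e0 : 0 < e by exact: expR_gt0.
have -> : e * E - e - e * u = e * (E - 1 - u) by ring.
rewrite ger0_norm; last by apply: mulr_ge0; [exact: ltW|lra].
(* Inserting E <= 1 + uE into itself gives the second-order remainder u^2 E, and e E <= 1 because u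
   <= 2. *)
have : E - 1 - u <= u ^+ 2 * E by have := ler_wpM2l u0 Eu; lra.
move/(ler_wpM2l (ltW e0)) => /le_trans; apply.
by rewrite mulrCA ler_piMr // sqr_ge0.
Qed.

End ExponentialBounds.

(** * Gaussian approximation of the binomial ratio *)

Section BinomialRatio.
Variable R : realType.
Variable m : nat.
Hypothesis m_gt0 : (0 < m)%N.

Local Notation ratio := (bin_ratio R m).
Local Notation c := (m%:R + 2^-1 : R).
Local Notation gauss r := (expR (- (r%:R ^+ 2 / c))).

Lemma bin_ratio_ge0 r : 0 <= ratio r.
Proof. by rewrite divr_ge0 ?ler0n. Qed.

Lemma bin_ratio0 : ratio 0 = 1.
Proof. by rewrite /bin_ratio addn0 divff // pnatr_eq0 -lt0n bin_gt0; lia. Qed.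

(* In terms of h = r + 1/2 and c = m + 1/2 the factor (m - r)/(m + r + 1) is
   (1 - x)/(1 + x) with x = h/c, the Pade approximant of exp(-2x). *)
Lemma bin_ratioS r : (r <= m)%N ->
  let x := (r%:R + 2^-1) / c in (1 + x) * ratio r.+1 = (1 - x) * ratio r.
Proof.
move=> rm /=.
have m0 : 0 <= m%:R :> R by [].
have C0 : 'C(m.*2, m)%:R != 0 :> R by rewrite pnatr_eq0 -lt0n bin_gt0; lia.
have e : (m + r).+1%:R * 'C(m.*2, (m + r).+1)%:R =
    (m - r)%:R * 'C(m.*2, m + r)%:R :> R.
  by rewrite -!natrM mul_bin_left; congr (_ * _)%:R; lia.
have c0 : c != 0 by rewrite gt_eqF //; lra.
have -> : 1 + (r%:R + 2^-1) / c = (m + r).+1%:R / c.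
  by rewrite -[(m + r).+1%:R]natr1 natrD; field.
have -> : 1 - (r%:R + 2^-1) / c = (m - r)%:R / c by rewrite natrB //; field.
by rewrite /bin_ratio addnS mulrACA e mulrACA.
Qed.

(** Since (r+1)^2 - r^2 = 2(r + 1/2), the Gaussian with denominator [c] has successive ratios
    exactly exp(-2x), for the same x as in [bin_ratioS]. *)
Lemma gaussS r : gauss r.+1 = gauss r * expR (- (2 * ((r%:R + 2^-1) / c))).
Proof.
rewrite -expRD; congr expR; rewrite -natr1.
have m0 : 0 <= m%:R :> R by [].
by field; rewrite gt_eqF //; lra.
Qed.

Lemma bin_ratio_le r : ratio r <= gauss r.
Proof.
have m0 : 0 <= m%:R :> R by [].
have r0 k : 0 <= k%:R :> R by [].
elim: r => [|r IHr]; first by rewrite bin_ratio0 expr0n mul0r oppr0 expR0.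
have [rm|mr] := leqP r m; last first.
  by rewrite /bin_ratio bin_small ?mul0r ?expR_ge0 //; lia.
have /= := bin_ratioS rm; rewrite gaussS; set x := _ / c => e.
have x0 : 0 <= x by apply: divr_ge0; have := r0 r; lra.
have x1 : x <= 1.
  by rewrite ler_pdivrMr ?mul1r ?lerD2r ?ler_nat //; lra.
rewrite -(@ler_pM2l _ (1 + x)) ?e; last by lra.
have := expR_pade_le x0; have := expRxMexpNx_1 (2 * x).
have := expR_gt0 (- (2 * x)).
move: (expR (2 * x)) (expR (- (2 * x))) => E F F0 EF pade.
have h : 1 - x <= (1 + x) * F.
  by have := ler_wpM2r (ltW F0) pade; rewrite -mulrA EF mulr1.
have := ler_wpM2l (expR_ge0 (- (r%:R ^+ 2 / c))) h.
have : (1 - x) * ratio r <= (1 - x) * gauss r by apply: ler_wpM2l => //; lra.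
lra.
Qed.

(** Each step loses at most a factor 1 - x^3 against the Gaussian, and the losses x^3 add up to at
    most r^4/c^3. *)
Lemma bin_ratio_ge r : gauss r * (1 - r%:R ^+ 4 / c ^+ 3) <= ratio r.
Proof.
have m0 : 1 <= m%:R :> R by rewrite ler1n.
have r0 k : 0 <= k%:R :> R by [].
have c3 : 0 < c ^+ 3 by rewrite exprn_gt0 //; lra.
elim: r => [|r IHr].
  by rewrite bin_ratio0 !exprS !mul0r oppr0 expR0 addr0 mulr1.
have [small|big] := leP (1 - r.+1%:R ^+ 4 / c ^+ 3) 0.
  apply: le_trans (bin_ratio_ge0 _); apply: mulr_ge0_le0 => //; exact: expR_ge0.
(* Otherwise r + 1 >= c, so (r+1)^4 >= c^3 and the lower bound would not be positive. *)
have rm : (r <= m)%N.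
  rewrite leqNgt; apply/negP => mr; move: big; apply/negP.
  rewrite -leNgt subr_le0 ler_pdivlMr // mul1r.
  have rc : c <= r.+1%:R.
    by have := ltnW mr; rewrite -(ler_nat R) -[r.+1%:R]natr1; lra.
  have -> : c ^+ 3 = c ^+ 3 * 1 by rewrite mulr1.
  rewrite [leRHS]exprSr; apply: ler_pM => //; try lra.
  by rewrite lerXn2r ?nnegrE //; lra.
have /= := bin_ratioS rm; rewrite gaussS; set x := _ / c => e.
have x0 : 0 <= x by apply: divr_ge0; have := r0 r; lra.
have x1 : x <= 1.
  by rewrite ler_pdivrMr ?mul1r ?lerD2r ?ler_nat //; lra.
rewrite -(@ler_pM2l _ (1 + x)) ?e; last by lra.
set A := r%:R ^+ 4 / c ^+ 3.
have A0 : 0 <= A by apply: divr_ge0; [exact: exprn_ge0 | exact: ltW].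
(* The accumulated loss advances because (r + 1)^4 - r^4 >= (r + 1/2)^3. *)
have AS : A + x ^+ 3 <= r.+1%:R ^+ 4 / c ^+ 3.
  rewrite /A /x expr_div_n -mulrDl ler_pM2r ?invr_gt0 // -[r.+1%:R]natr1.
  move: (r0 r); move: (r%:R) => y y0; rewrite -subr_ge0.
  have -> : (y + 1) ^+ 4 - (y ^+ 4 + (y + 2^-1) ^+ 3) =
      3 * y ^+ 3 + 9 / 2 * y ^+ 2 + 13 / 4 * y + 7 / 8 by field.
  by have := exprn_ge0 3 y0; have := exprn_ge0 2 y0; lra.
have := expR_pade_ge x0; have := expRxMexpNx_1 (2 * x).
have := expR_gt0 (- (2 * x)).
move: (expR (2 * x)) (expR (- (2 * x))) => E F F0 EF pade.
have h : (1 + x) * F * (1 - x ^+ 3) <= 1 - x.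
  have -> : (1 + x) * F * (1 - x ^+ 3) =
    (1 - x) * (F * ((1 + x) * (1 + x + x ^+ 2))) by ring.
  rewrite ler_piMr ?subr_ge0 //.
  by have := ler_wpM2l (ltW F0) pade; rewrite [F * E]mulrC EF.
move: IHr; rewrite -/A; set G := expR (- (_ / _)) => IHr.
have G0 : 0 < G by exact: expR_gt0.
move: AS big; set A' := r.+1%:R ^+ 4 / _ => AS big.
have x3 : 0 <= x ^+ 3 by rewrite exprn_ge0.
apply: (@le_trans _ _ ((1 + x) * F * (1 - x ^+ 3) * (G * (1 - A)))).
  have -> : (1 + x) * (G * F * (1 - A')) = ((1 + x) * F * G) * (1 - A') by ring.
  have -> : (1 + x) * F * (1 - x ^+ 3) * (G * (1 - A)) =
    ((1 + x) * F * G) * ((1 - x ^+ 3) * (1 - A)) by ring.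
  apply: ler_wpM2l; first by rewrite !mulr_ge0 ?ltW //; lra.
  by have := mulr_ge0 A0 x3; lra.
have x31 : x ^+ 3 <= 1 by rewrite exprn_ile1.
apply: ler_pM => //; apply: mulr_ge0; try lra.
by apply: mulr_ge0; [lra|exact: ltW].
Qed.

(** With y = r^2/c the loss is y^2 exp(-y)/c <= 2/c. Replacing c by m adds y/(2m) to the exponent,
    which costs at most y exp(-y)/m <= 1/m. Both bounds are uniform in [r]. *)
Lemma bin_ratio_gauss r : `|ratio r - expR (- (r%:R ^+ 2 / m%:R))| <= 3 / m%:R.
Proof.
have m0 : 1 <= m%:R :> R by rewrite ler1n.
have le_r := bin_ratio_le r; have ge_r := bin_ratio_ge r.
set y := r%:R ^+ 2 / c in le_r ge_r.
have y0 : 0 <= y by rewrite divr_ge0 ?sqr_ge0 //; lra.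
have e4 : r%:R ^+ 4 / c ^+ 3 = y ^+ 2 / c.
  by rewrite /y; field; rewrite gt_eqF //; lra.
have e2 : r%:R ^+ 2 / m%:R = y + y / (2 * m%:R).
  by rewrite /y; field; apply/andP; split; rewrite gt_eqF //; lra.
rewrite e4 in ge_r; rewrite e2.
have b1 := mulr_expRN_le1 y; have b2 := sqr_expRN_le2 y0.
have d1 : expR (- y) - 2 / m%:R <= ratio r.
  apply: le_trans ge_r; rewrite mulrBr mulr1 lerD2l lerN2.
  rewrite mulrA [_ * y ^+ 2]mulrC ler_pM ?invr_ge0 //; try lra.
  - by rewrite mulr_ge0 ?sqr_ge0 ?expR_ge0.
  - by rewrite lef_pV2 ?posrE; lra.
have d2 : expR (- y) - 1 / m%:R <= expR (- (y + y / (2 * m%:R))).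
  rewrite opprD expRD; set d := y / _.
  have := ler_wpM2l (expR_ge0 (- y)) (expR_ge1Dx (- d)).
  apply: le_trans; rewrite mulrDr mulr1 lerD2l mulrN lerN2 /d mulrA.
  rewrite [_ * y]mulrC.
  rewrite ler_pM ?invr_ge0 ?mulr_ge0 ?expR_ge0 //; try lra.
have d3 : expR (- (y + y / (2 * m%:R))) <= expR (- y).
  by rewrite ler_expR lerN2 lerDl divr_ge0 //; lra.
have mV : 0 < m%:R^-1 :> R by rewrite invr_gt0; lra.
rewrite ler_norml; apply/andP; split; lra.
Qed.

End BinomialRatio.

(** * Comparison with the exponential tail *)

Lemma bin_ratio_expR (R : realType) m r (t : R) : (0 < m)%N -> (0 < r)%N ->
  (r * r.-1)%:R <= m%:R * t <= (r * r.+1)%:R ->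
  `|bin_ratio R m r - expR (- t)| <= 4 / Num.sqrt m%:R.
Proof.
move=> m0; case: r => // r _ /=; pose z : R := r.+1%:R.
have z1 : 1 <= z by rewrite ler1n.
rewrite !natrM -[r.+2%:R]natr1 -/z.
have -> : r%:R = z - 1 :> R by rewrite /z -[r.+1%:R]natr1 addrK.
case/andP=> t_ge t_le.
have mR1 : 1 <= m%:R :> R by rewrite ler1n.
set s := Num.sqrt m%:R.
have s1 : 1 <= s by rewrite -sqrtr1 ler_sqrt //; lra.
have s2 : s ^+ 2 = m%:R by rewrite sqr_sqrtr //; lra.
have b1 := bin_ratio_gauss R m0 r.+1.
(* Both exponents are at least r(r-1)/m and differ by at most r/m. *)
have b2 : `|expR (- (z ^+ 2 / m%:R)) - expR (- t)| <=
    z / m%:R * expR (- (z * (z - 1) / m%:R)).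
  apply: expRN_dist.
  - by rewrite ler_pM2r ?invr_gt0; nra.
  - by rewrite ler_pdivrMr; lra.
  - rewrite ler_norml; apply/andP; split; rewrite -(@ler_pM2r _ m%:R);
      by rewrite ?mulrBl ?mulNr ?divfK ?gt_eqF //; nra.
pose w := z / s.
have w0 : 0 <= w by rewrite divr_ge0; lra.
have b3 : z / m%:R * expR (- (z * (z - 1) / m%:R)) <= 1 / s.
  have -> : z / m%:R = w / s by rewrite /w -s2; field; rewrite gt_eqF //; lra.
  have -> : z * (z - 1) / m%:R = w ^+ 2 - w / s.
    by rewrite /w -s2; field; rewrite gt_eqF //; lra.
  rewrite mulrAC ler_pM2r ?invr_gt0; last lra.
  have ws : w / s <= w by rewrite ler_pdivrMr; [exact: ler_peMr|lra].
  (* Since s >= 1, w^2 - w/s >= w^2 - w >= w - 1 by (w - 1)^2 >= 0; then w <= exp(w - 1)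
     finishes. *)
  apply: (@le_trans _ _ (w * expR (- (w - 1)))).
    apply: ler_wpM2l => //; rewrite ler_expR lerN2.
    by have := sqr_ge0 (w - 1); lra.
  rewrite expRN ler_pdivrMr ?expR_gt0 // mul1r.
  by have := expR_ge1Dx (w - 1); lra.
have b4 : 3 / m%:R <= 3 / s.
  by rewrite ler_pM2l // lef_pV2 ?posrE -?s2; nra.
have := ler_distD (expR (- (z ^+ 2 / m%:R))) (bin_ratio R m r.+1) (expR (- t)).
lra.
Qed.

(** * The distance between the distribution functions *)

Section CdfGap.
Variables (R : realType) (m : nat).
Hypothesis m_gt0 : (0 < m)%N.
Variables (d : measure_display) (T : measurableType d) (P : probability T R)
  (tau : {RV P >-> R}).
Variables (d' : measure_display) (T' : measurableType d') (Q : probability T' R)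
  (Z : {RV Q >-> R}).
Hypothesis tauP : uniform_eigenvalue m.*2 tau.
Hypothesis ZP : exponential_mean1 Z.

Lemma exponential_mean1_cdf (t : R) :
  fine (Q [set y | Z y <= t]) = if 0 <= t then 1 - expR (- t) else 0.
Proof.
have -> : [set y | Z y <= t] = Z @^-1` `]-oo, t]%classic.
  by apply/seteqP; split=> y /=; rewrite in_itv.
rewrite -[X in fine X]/(distribution Q Z _) ZP; last exact: measurable_itv.
by rewrite exponential_cdf.
Qed.

Lemma cdf_gap_neg (t : R) : t < 0 -> cdf_gap P (bl_W m.*2 tau) Q Z t = 0.
Proof.
move=> t0; rewrite /cdf_gap exponential_mean1_cdf ltNge in t0 *.
rewrite (negPf t0) (@bl_cdf _ _ _ _ _ _ _ 0) //=.
  by rewrite bin_ratio0 // subrr subr0 normr0.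
move=> i im; apply/negbTE; apply: contra t0; apply: le_trans.
by rewrite divr_ge0.
Qed.

Lemma cdf_gapE (t : R) r : (0 < r)%N ->
  (r * r.-1)%:R <= m%:R * t < (r * r.+1)%:R ->
  cdf_gap P (bl_W m.*2 tau) Q Z t = `|bin_ratio R m r - expR (- t)|.
Proof.
move=> r0 /andP[rt tr]; have mR : 0 < m%:R :> R by rewrite ltr0n.
have t0 : 0 <= t by rewrite -(pmulr_rge0 _ mR); apply: le_trans rt.
rewrite /cdf_gap exponential_mean1_cdf t0 (bl_cdf m_gt0 tauP (r := r)) /=.
  by rewrite distrC; congr `|_|; ring.
move=> i _; rewrite ler_pdivrMr // mulrC; case: ltnP => ir.
  apply: le_trans rt; rewrite ler_nat; nia.
apply/negbTE; rewrite -ltNge; apply: lt_le_trans tr _; rewrite ler_nat; nia.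
Qed.

Lemma cdf_gap_le (t : R) :
  cdf_gap P (bl_W m.*2 tau) Q Z t <= 4 / Num.sqrt m%:R.
Proof.
have [t0|t0] := ltP t 0; first by rewrite cdf_gap_neg // divr_ge0 ?sqrtr_ge0.
have mt0 : 0 <= m%:R * t by rewrite mulr_ge0.
(* The least such [r] locates [t]: minimality, applied to r - 1, gives r(r-1) <= mt. *)
have ex_r : exists r, m%:R * t < (r * r.+1)%:R.
  exists (Num.bound (m%:R * t)); apply: lt_le_trans (archi_boundP mt0) _.
  by rewrite ler_nat; nia.
have [r mt_lt r_min] := ex_minnP ex_r.
have r0 : (0 < r)%N.
  by rewrite lt0n; apply: contraTneq mt_lt => ->; rewrite -leNgt.
have mt_ge : (r * r.-1)%:R <= m%:R * t.
  rewrite leNgt; apply/negP => lt_r; have := r_min r.-1.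
  by rewrite prednK // mulnC => /(_ lt_r); lia.
rewrite (@cdf_gapE t r) ?mt_ge // bin_ratio_expR // mt_ge ltW //.
Qed.

End CdfGap.

(** * Sharpness along n = 4s^2 *)

(** Here m = 2s^2, r = 2s, and t = 2 - 1/s = r(r-1)/m is the left end of its step, while r^2/m = 2.
    The Gaussian error 3/m and the Taylor error 1/s^2 add up to 5/(2s^2), below 12/n = 3/s^2. *)
Lemma cdf_gap_sharp (R : realType) s (d : measure_display)
    (T : measurableType d) (P : probability T R) (tau : {RV P >-> R})
    (d' : measure_display) (T' : measurableType d') (Q : probability T' R)
    (Z : {RV Q >-> R}) : (0 < s)%N ->
  uniform_eigenvalue (2 * s ^ 2).*2 tau -> exponential_mean1 Z ->
  `|cdf_gap P (bl_W (2 * s ^ 2).*2 tau) Q Z (2 - s%:R^-1)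
    - 2 * expR (- 2) / Num.sqrt (2 * s ^ 2).*2%:R| <= 12 / (2 * s ^ 2).*2%:R.
Proof.
move=> s0 tauP ZP; have sR : 1 <= s%:R :> R by rewrite ler1n.
have m0 : (0 < 2 * s ^ 2)%N by rewrite muln_gt0 expn_gt0 s0.
have mE : (2 * s ^ 2)%:R = 2 * s%:R ^+ 2 :> R by rewrite natrM natrX.
have nE : (2 * s ^ 2).*2%:R = (2 * s%:R) ^+ 2 :> R.
  by rewrite -mul2n natrM mE; ring.
have sV0 : 0 < s%:R^-1 :> R by rewrite invr_gt0; lra.
have sV1 : s%:R^-1 <= 1 :> R by rewrite invf_le1; lra.
rewrite (@cdf_gapE _ _ m0 _ _ _ _ _ _ _ _ tauP ZP _ (2 * s)); last first.
- have pE : (2 * s).-1%:R = 2 * s%:R - 1 :> R.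
    by rewrite -subn1 natrB; [rewrite natrM|lia].
  have -> : (2 * s ^ 2)%:R * (2 - s%:R^-1) = (2 * s * (2 * s).-1)%:R :> R.
    by rewrite mE !natrM pE; field; rewrite gt_eqF; lra.
  by rewrite lexx ltr_nat; nia.
- by rewrite muln_gt0.
have -> : Num.sqrt (2 * s ^ 2).*2%:R = 2 * s%:R :> R.
  by rewrite nE sqrtr_sqr ger0_norm; lra.
rewrite nE.
have := bin_ratio_gauss R m0 (2 * s).
have -> : (2 * s)%:R ^+ 2 / (2 * s ^ 2)%:R = 2 :> R.
  by rewrite mE natrM; field; rewrite gt_eqF; lra.
have : `|expR (- (2 - s%:R^-1)) - expR (- 2) - expR (- 2) * s%:R^-1| <=
    s%:R^-1 ^+ 2 :> R.
  by apply: expR_sub2; lra.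
have -> : 2 * expR (- 2) / (2 * s%:R) = expR (- 2) * s%:R^-1 :> R.
  by field; rewrite gt_eqF; lra.
have -> : 12 / (2 * s%:R) ^+ 2 = 3 * s%:R^-1 ^+ 2 :> R.
  by field; rewrite gt_eqF; lra.
have -> : 3 / (2 * s ^ 2)%:R = 3 / 2 * s%:R^-1 ^+ 2 :> R.
  by rewrite mE; field; rewrite gt_eqF; lra.
have e0 : 0 < expR (- 2) :> R by exact: expR_gt0.
have q0 : 0 <= s%:R^-1 ^+ 2 :> R by exact: sqr_ge0.
have eq0 : 0 < expR (- 2) * s%:R^-1 :> R by rewrite mulr_gt0 //; lra.
move: e0 q0 eq0; set e := expR (- 2); set q := _ ^+ 2; set w := e * _.
move=> e0 q0 w0; rewrite !ler_norml => /andP[? ?] /andP[? ?].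
(* The signed difference is -w up to the error. If it is nonnegative, then w itself is at most the
   error, and the bound still holds. *)
case: ger0P => ?.
  by apply/andP; split; lra.
by apply/andP; split; lra.
Qed.

(** * The uniform bound and its sharpness *)

Theorem theorem1p4 (R : realType) :
  (exists C : R,
    forall n : nat, (0 < n)%N -> ~~ odd n ->
    forall (d : measure_display) (T : measurableType d) (P : probability T R)
      (tau : {RV P >-> R})
      (d' : measure_display) (T' : measurableType d') (Q : probability T' R)
      (Z : {RV Q >-> R}),
    uniform_eigenvalue n tau -> exponential_mean1 Z ->
    forall t : R, cdf_gap P (bl_W n tau) Q Z t <= C / Num.sqrt n%:R)
  /\
  (exists (n_ : nat -> nat) (t_ : nat -> R),
    [/\ forall k, (0 < n_ k)%N /\ ~~ odd (n_ k),
        n_ @ \oo --> \oo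
      & forall (d : nat -> measure_display)
          (T : forall k, measurableType (d k))
          (P : forall k, probability (T k) R)
          (tau : forall k, {RV (P k) >-> R})
          (d' : measure_display) (T' : measurableType d')
          (Q : probability T' R) (Z : {RV Q >-> R}),
        (forall k, uniform_eigenvalue (n_ k) (tau k)) ->
        exponential_mean1 Z ->
        (fun k => cdf_gap (P k) (bl_W (n_ k) (tau k)) Q Z (t_ k)
                  - 2 * expR (- 2) / Num.sqrt (n_ k)%:R : R^o)
          =O_\oo (fun k => (n_ k)%:R^-1 : R^o)]).
Proof.
split.
  (* With n = 2m the bound 4/sqrt m equals 4 sqrt 2/sqrt n, and 4 sqrt 2 <= 8. *)
  exists 8 => n n0 n_even d T P tau d' T' Q Z tauP ZP t.
  have nE : n = n./2.*2 by rewrite -[LHS]odd_double_half (negPf n_even).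
  have m0 : (0 < n./2)%N by lia.
  rewrite nE in tauP *; move: (n./2) m0 tauP => m m0 tauP.
  apply: le_trans (cdf_gap_le m0 tauP ZP t) _.
  have -> : m.*2%:R = 2 * m%:R :> R by rewrite -mul2n natrM.
  rewrite sqrtrM //.
  have sm : 0 < Num.sqrt m%:R :> R by rewrite sqrtr_gt0 ltr0n.
  have s2 : 0 < Num.sqrt 2 :> R by rewrite sqrtr_gt0.
  rewrite invfM mulrA ler_pM2r ?invr_gt0 // ler_pdivlMr //.
  have : Num.sqrt 2 ^+ 2 = 2 :> R by rewrite sqr_sqrtr.
  nra.
(* The sequence n = 4s^2 with s = k + 1, so that s is positive. *)
exists (fun k => (2 * k.+1 ^ 2).*2), (fun k => 2 - k.+1%:R^-1); split.
- by move=> k; rewrite odd_double double_gt0 muln_gt0 expn_gt0.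
- apply/cvgnyPge => A; near=> k.
  have : (A <= k)%N by near: k; exact: nbhs_infty_ge.
  nia.
move=> d T P tau d' T' Q Z tauP ZP.
apply/eqO_exP; exists 12 => //; apply: nearW => k /=.
rewrite (@ger0_norm _ (_^-1)) ?invr_ge0 //.
exact: cdf_gap_sharp.
Unshelve. all: by end_near.
Qed.
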